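(* There is a constant $C$ such that every lollipop graph $G$ with $n$ vertices satisfies $\widetilde{\mathsf{EC}}(G)\le Cn^3$ for the unweighted deterministic walk with bounded $\tilde\kappa$.
   Context: The lollipop graph on $n$ vertices consists of a clique on $n/2$ vertices and a path on the remaining $n/2$ vertices, one endpoint of the path being joined by an edge to one vertex of the clique. Unweighted deterministic walk: each vertex $u$ has a rotor sequence of length $\tilde d(u)$ of neighbours of $u$, each occurring exactly $\tilde d(u)/\deg(u)$ times, and an initial rotor position; $\tilde\kappa=\max_u\tilde d(u)/\deg(u)$; the constant $C$ may depend on an upper bound on $\tilde\kappa$. The walk moves from the current vertex to the vertex its rotor points at and then advances that rotor cyclically. $\widetilde{\mathsf{EC}}(G)$ is the maximum over start vertices and all rotor sequences/initial positions (lengths fixed) of the first time every edge has been traversed. (The paper states its bounds for specific graphs under the standing assumption $\tilde\kappa=O(1)$.) *)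

(* Defs.v *)
From mathcomp Require Import all_boot.

Set Implicit Arguments.
Unset Strict Implicit.
Unset Printing Implicit Defensive.

(* Adjacency on {0, ..., n-1}, n even: 0, ..., n/2 - 1 form the clique,
   n/2, ..., n-1 the path, and n/2 - 1 -- n/2 is the edge joining them. *)
Definition lollipop_adj (n : nat) : rel 'I_n := fun i j =>
  (i != j) &&
  [|| (i < n./2) && (j < n./2), i.+1 == j :> nat | j.+1 == i :> nat].

(* The graph (T, e) is a lollipop graph, on #|T| vertices. *)
Definition is_lollipop (T : finType) (e : rel T) : Prop :=
  [/\ 0 < #|T|, ~~ odd #|T| &
      exists2 f : T -> 'I_#|T|, bijective f &
        forall u v, e u v = lollipop_adj (f u) (f v)].

Definition deg (T : finType) (e : rel T) (u : T) : nat := #|[set v | e u v]|.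

(* Admissible rotor lengths: d u / deg u is a positive integer, as it has to
   be the multiplicity of each neighbour of u in the rotor sequence of u. *)
Definition rotor_lengths (T : finType) (e : rel T) (d : T -> nat) : Prop :=
  forall u, 0 < d u /\ deg e u %| d u.

Definition kappa (T : finType) (e : rel T) (d : T -> nat) : nat :=
  \max_(u : T) (d u %/ deg e u).

Definition rotor_sequences (T : finType) (e : rel T) (d : T -> nat)
    (rho : T -> seq T) : Prop :=
  forall u, [/\ size (rho u) = d u,
                {in rho u, forall v, e u v} &
                forall v, e u v -> count_mem v (rho u) = d u %/ deg e u].

Definition rotor_positions (T : finType) (d : T -> nat) (p : T -> nat) : Prop :=
  forall u, p u < d u.

(* A state is the current vertex together with all the rotor positions. The
   default value of nth is never used when the positions are in range. *)
Definition walk_step (T : finType) (rho : T -> seq T)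
    (s : T * (T -> nat)) : T * (T -> nat) :=
  let: (x, p) := s in
  (nth x (rho x) (p x),
   fun u => if u == x then (p x).+1 %% size (rho x) else p u).

Definition walk (T : finType) (rho : T -> seq T) (p : T -> nat) (x : T)
    (t : nat) : T :=
  (iter t (walk_step rho) (x, p)).1.

(* Edges are undirected: {u, v} may be traversed in either direction. *)
Definition traversed (T : finType) (w : nat -> T) (t : nat) (u v : T) : Prop :=
  exists2 s, s < t &
    (w s = u /\ w s.+1 = v) \/ (w s = v /\ w s.+1 = u).

Definition edges_covered (T : finType) (e : rel T) (w : nat -> T) (t : nat) :
    Prop :=
  forall u v, e u v -> traversed w t u v.

Definition first_cover_time (T : finType) (e : rel T) (w : nat -> T) (t : nat) :
    Prop :=
  edges_covered e w t /\ forall s, edges_covered e w s -> t <= s.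

Definition is_det_walk (T : finType) (e : rel T) (d : T -> nat)
    (w : nat -> T) : Prop :=
  exists (x : T) (rho : T -> seq T) (p : T -> nat),
    [/\ rotor_sequences e d rho, rotor_positions d p & w = walk rho p x].

(* N is the edge cover time of (T, e) with rotor lengths d: every walk covers
   the edges in finite time, and N is the maximum of the first cover times. *)
Definition is_edge_cover_time (T : finType) (e : rel T) (d : T -> nat)
    (N : nat) : Prop :=
  (exists2 w, is_det_walk e d w & first_cover_time e w N) /\
  (forall w, is_det_walk e d w -> exists2 t, first_cover_time e w t & t <= N).

(* Main.v *)
Require Import Defs.
From mathcomp Require Import all_boot zify.
From Stdlib Require Import Classical.

Set Implicit Arguments.
Unset Strict Implicit.
Unset Printing Implicit Defensive.

(** Run the walk for [t] steps, let [r u] be the number of full turns of the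
    rotor of [u], and let [a u = kappa_u * r u]; an edge [u -> v] has then been
    used between [a u] and [a u + K] times. Across any cut the numbers of
    crossings in the two directions differ by at most one, so in a connected
    graph the values of [a] leave no gap longer than [K + 1]. Hence if some rotor
    has not yet made a full turn, then [a <= (n - 1) (K + 1)] everywhere, and
    [t] is less than [\sum_u deg u * (a u + K) <= (K + 1) n^3]. *)

(** * Extrema of propositional predicates on natural numbers *)

Lemma exists_least (P : nat -> Prop) (n : nat) :
  P n -> exists2 m, P m & forall k, P k -> m <= k.
Proof.
elim/ltn_ind: n => n IHn Pn.
have [[k lt_kn Pk] | least_n] := classic (exists2 k, k < n & P k).
  exact: IHn lt_kn Pk.
exists n => // k Pk; rewrite leqNgt; apply/negP => lt_kn.
by apply: least_n; exists k.
Qed.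

Lemma exists_greatest (P : nat -> Prop) (m B : nat) :
  P m -> (forall k, P k -> k <= B) -> exists2 n, P n & forall k, P k -> k <= n.
Proof.
move=> Pm; elim: B => [|B IHB] leB.
  by exists m => // k /leB; rewrite leqn0 => /eqP ->.
have [PB | nPB] := classic (P B.+1); first by exists B.+1.
apply: IHB => k Pk; have := leB k Pk; rewrite leq_eqVlt => /orP[/eqP kB|] //.
by case: nPB; rewrite -kB.
Qed.

(** * Occurrences of a value in a window of a periodic sequence *)

Section CyclicCount.

Variables (T : eqType) (x0 : T) (s : seq T) (v : T).

(** Sliding the window by one drops the index [p] and gains [p + size s], which agree modulo
    [size s]. *)
Lemma sum_cycle p :
  \sum_(p <= j < p + size s) (nth x0 s (j %% size s) == v) = count_mem v s.
Proof.
elim: p => [|p IHp].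
  rewrite add0n -[in RHS](mkseq_nth x0 s) /mkseq count_map -sum1_count.
  rewrite [RHS]big_mkcond.
  rewrite /index_iota subn0 !big_seq; apply: eq_bigr => j.
  by rewrite mem_iota /= add0n => j_lt; rewrite modn_small //; case: (_ == v).
case: (posnP (size s)) => [s0 | s_gt0]; first by rewrite -IHp s0 !addn0 !big_geq.
rewrite -IHp addSn big_nat_recr /=; last by lia.
by rewrite [RHS]big_ltn ?modnDr 1?addnC //; lia.
Qed.

Lemma sum_cycles p q :
  \sum_(p <= j < p + q * size s) (nth x0 s (j %% size s) == v)
    = q * count_mem v s.
Proof.
elim: q => [|q IHq]; first by rewrite big_geq // addn0.
rewrite (@big_cat_nat _ _ _ (p + q * size s)) /=; [|lia|lia].
by rewrite IHq (_ : p + q.+1 * _ = p + q * size s + size s) ?sum_cycle; lia.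
Qed.

(** The window contains [x %/ size s] whole cycles and is contained in one cycle more. *)
Lemma sum_cyclic_bounds p x : 0 < size s ->
  count_mem v s * (x %/ size s)
    <= \sum_(p <= j < p + x) (nth x0 s (j %% size s) == v)
    <= count_mem v s * (x %/ size s).+1.
Proof.
move=> s_gt0; rewrite ![count_mem v s * _]mulnC -!(sum_cycles p).
have lex := leq_trunc_div x (size s); have ltx := ltn_ceil x s_gt0.
apply/andP; split.
  by rewrite [leqRHS](@big_cat_nat _ _ _ (p + x %/ size s * size s)) ?leq_addr //=; lia.
by rewrite [leqRHS](@big_cat_nat _ _ _ (p + x)) ?leq_addr //=; lia.
Qed.

End CyclicCount.

(** * Visits, directed crossings and the balance across a cut *)

Section Counting.

Variables (T : finType) (w : nat -> T).

Definition visits (t : nat) (u : T) : nat := \sum_(s < t) (w s == u).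

Definition crossings (t : nat) (u v : T) : nat :=
  \sum_(s < t) ((w s == u) && (w s.+1 == v)).

Lemma sum_visits t : \sum_u visits t u = t.
Proof.
rewrite exchange_big /= (eq_bigr (fun=> 1)) ?sum1_card ?card_ord // => s _.
rewrite (bigD1 (w s)) //= eqxx big1 // => u /negbTE.
by rewrite eq_sym => ->.
Qed.

Lemma sum_crossings (A B : {set T}) t :
  \sum_(u in A) \sum_(v in B) crossings t u v
    = \sum_(s < t) ((w s \in A) && (w s.+1 \in B)).
Proof.
have ind (C : {set T}) x : \sum_(u in C) (x == u) = (x \in C).
  have [xC | xC] := boolP (x \in C).
    rewrite (bigD1 x) //= eqxx big1 // => u /andP[_ /negbTE].
    by rewrite eq_sym => ->.
  by rewrite big1 // => u uC; case: eqP => // xu; rewrite xu uC in xC.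
under eq_bigr => u _ do rewrite exchange_big /=.
rewrite exchange_big /=; apply: eq_bigr => s _.
rewrite -mulnb -!ind big_distrl /=; apply: eq_bigr => u _.
by rewrite big_distrr /=; apply: eq_bigr => v _; rewrite mulnb.
Qed.

(** Exits from [A] and entries into [A] alternate, so their difference is fixed by the two ends of
    the walk. *)
Lemma cut_balance (A : {set T}) t :
  \sum_(u in A) \sum_(v in ~: A) crossings t u v + (w t \in A)
    = \sum_(u in ~: A) \sum_(v in A) crossings t u v + (w 0 \in A).
Proof.
rewrite !sum_crossings; elim: t => [|t IHt]; first by rewrite !big_ord0.
rewrite !big_ord_recr /= !inE; move: IHt.
by case: (w t \in A); case: (w t.+1 \in A) => /=; lia.
Qed.

Lemma crossings_traversed t u v : 0 < crossings t u v -> traversed w t u v.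
Proof.
rewrite lt0n sum_nat_eq0 negb_forall => /existsP[s].
by rewrite eqb0 negbK => /andP[/eqP ? /eqP ?]; exists s => //; left.
Qed.

End Counting.

(** * Crossings of a deterministic walk in terms of rotor turns *)

Section Walk.

Variables (T : finType) (e : rel T) (d : T -> nat).
Variables (rho : T -> seq T) (p : T -> nat) (x : T).
Hypotheses (rhoP : rotor_sequences e d rho) (pP : rotor_positions d p).

Let w := walk rho p x.

Lemma rotor_state t u :
  (iter t (walk_step rho) (x, p)).2 u = (p u + visits w t u) %% size (rho u).
Proof.
elim: t => [|t IHt].
  by rewrite /visits big_ord0 addn0 modn_small //; case: (rhoP u) => -> _ _.
rewrite iterS /visits big_ord_recr /= -/(visits w t u) /w /walk.
case: (iter t _ _) IHt => y q /= IHt; rewrite eq_sym; case: eqP => [->|_].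
  by rewrite IHt -addn1 modnDml addnA.
by rewrite addn0.
Qed.

Lemma walk_next t : let u := w t in
  w t.+1 = nth u (rho u) ((p u + visits w t u) %% size (rho u)).
Proof.
rewrite /= -rotor_state /w /walk iterS.
by case: (iter t _ _).
Qed.

(** Successive visits to [u] read consecutive entries of its rotor sequence, starting at [p u]. *)
Lemma crossings_rotor t u v :
  crossings w t u v =
    \sum_(p u <= j < p u + visits w t u) (nth u (rho u) (j %% size (rho u)) == v).
Proof.
elim: t => [|t IHt]; first by rewrite /crossings /visits !big_ord0 addn0 big_geq.
rewrite /crossings /visits !big_ord_recr /= -/(visits _ _ _) -/(crossings _ _ _ _).
rewrite IHt walk_next; case: eqP => [<-|_] /=; last by rewrite !addn0.
by rewrite addnA addn1 big_nat_recr ?leq_addr.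
Qed.

Hypothesis dP : rotor_lengths e d.

(** This is [a u] of the overview: full turns weighted by the multiplicity of a neighbour in one
    turn. *)
Definition turns t u := d u %/ deg e u * (visits w t u %/ d u).

Lemma crossings_bounds t u v : e u v ->
  turns t u <= crossings w t u v <= turns t u + d u %/ deg e u.
Proof.
move=> euv; have [sz _ cnt] := rhoP u; have [d_gt0 _] := dP u.
rewrite crossings_rotor /turns -(cnt v euv) -sz -mulnSr.
by apply: sum_cyclic_bounds; rewrite sz.
Qed.

Lemma crossings_nonedge t u v : ~~ e u v -> crossings w t u v = 0.
Proof.
move=> neuv; have [sz mem_rho _] := rhoP u; have [d_gt0 _] := dP u.
rewrite crossings_rotor big1 // => j _; case: eqP => // rho_v.
by rewrite -rho_v mem_rho // in neuv; rewrite mem_nth // ltn_mod sz.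
Qed.

(** The right-hand side is [d u] times one more than the number of full turns. *)
Lemma visits_lt t u : visits w t u < deg e u * (turns t u + d u %/ deg e u).
Proof.
have [d_gt0 dvd_d] := dP u; rewrite /turns -mulnSr mulnA mulnC.
by rewrite [deg e u * _]mulnC divnK // ltn_ceil.
Qed.

(** * Connectivity limits the spread of [turns] *)

Hypotheses (e_sym : symmetric e) (e_conn : forall u v, connect e u v).
Variable K : nat.
Hypothesis kappa_le : kappa e d <= K.

Lemma multiplicity_le u : d u %/ deg e u <= K.
Proof. exact: leq_trans (leq_bigmax u) kappa_le. Qed.

Lemma crossing_edge (A : {set T}) u v : u \in A -> v \notin A ->
  exists y z, [/\ y \in A, z \notin A & e y z].
Proof.
move=> uA vA.
have [/existsP[y /existsP[z /and3P[]]] | no_edge] :=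
  boolP [exists y, exists z, [&& y \in A, z \notin A & e y z]].
  by exists y, z.
have clA : closed e (mem A).
  apply: intro_closed; first exact: sym_connect_sym.
  move=> y z eyz yA; apply: contraNT no_edge => zA.
  by apply/existsP; exists y; apply/existsP; exists z; rewrite yA eyz zA.
by have := closed_connect clA (e_conn u v); rewrite /= uA (negbTE vA).
Qed.

(** Otherwise each edge between the low set [A] and its complement is used at most [theta + K] times
    outwards and at least [theta + K + 2] times inwards, against the balance across the cut. *)
Lemma no_gap t theta u v : turns t u <= theta -> theta < turns t v ->
  exists2 z, theta < turns t z & turns t z <= theta + K.+1.
Proof.
move=> u_le v_gt; pose A := [set y | turns t y <= theta].
have uA : u \in A by rewrite inE.
have vA : v \notin A by rewrite inE -ltnNge.
have [a [b [aA bA eab]]] := crossing_edge uA vA.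
have [/existsP[z /andP[z1 z2]] | no_z] :=
  boolP [exists z, (theta < turns t z) && (turns t z <= theta + K.+1)].
  by exists z.
have high z : z \notin A -> theta + K.+1 < turns t z.
  rewrite inE -ltnNge => zA; rewrite ltnNge; apply: contra no_z => z_le.
  by apply/existsP; exists z; rewrite zA.
have gain y z : y \in A -> z \in ~: A ->
    crossings w t y z + 2 * e y z <= crossings w t z y.
  rewrite !inE => yA; rewrite -[~~ _]/(~~ (turns t z <= theta)) => zA.
  have [eyz | neyz] := boolP (e y z); last by rewrite crossings_nonedge.
  have /andP[_ c1] := crossings_bounds t eyz.
  have ezy : e z y by rewrite e_sym.
  have /andP[c2 _] := crossings_bounds t ezy.
  have := multiplicity_le y; have := high z; rewrite inE => /(_ zA); lia.
have bal := cut_balance w A t.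
suff : \sum_(y in A) \sum_(z in ~: A) crossings w t y z + 2
       <= \sum_(z in ~: A) \sum_(y in A) crossings w t z y.
  (* The balance allows a difference of at most 1, so a surplus of 2 is absurd. *)
  by move: bal; case: (_ \in A); case: (_ \in A); lia.
rewrite [leqRHS]exchange_big /=.
apply: leq_trans (_ : \sum_(y in A) \sum_(z in ~: A)
                        (crossings w t y z + 2 * e y z) <= _); last first.
  by apply: leq_sum => y yA; apply: leq_sum => z zA; apply: gain.
under [leqRHS]eq_bigr => y _ do rewrite big_split.
(* The single edge from [a] to [b] already supplies the surplus of 2. *)
rewrite big_split /= leq_add2l (bigD1 a) //= (bigD1 b) ?inE //=; last first.
  by rewrite inE in bA.
by rewrite eab -addnA leq_addr.
Qed.

(** By [no_gap], the sublevel sets [A j] gain a vertex at each step until they exhaust the graph,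
    which takes at most [#|T|.-1] steps. *)
Lemma turns_spread t u v : turns t u = 0 -> turns t v <= #|T|.-1 * K.+1.
Proof.
move=> u0; pose A j := [set y | turns t y <= j * K.+1].
have cardA j : (forall y, y \in A j) \/ j < #|A j|.
  elim: j => [|j IHj].
    by right; apply/card_gt0P; exists u; rewrite inE u0.
  have sub y : y \in A j -> y \in A j.+1 by rewrite !inE; lia.
  case: IHj => [all_j | lt_j]; first by left => y; apply: sub.
  have [all_j | /forallPn[y yA]] := boolP [forall y, y \in A j].
    by left => y; apply/sub/(forallP all_j).
  right; apply: leq_ltn_trans lt_j _; apply: proper_card.
  rewrite inE -ltnNge in yA.
  have [|z z_gt z_le] := no_gap _ yA (u := u); first by rewrite u0.
  apply/properP; split; first by apply/subsetP => y'; apply: sub.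
  by exists z; rewrite inE; [rewrite mulSn addnC | rewrite -ltnNge].
have [/(_ v) | full] := cardA #|T|.-1; first by rewrite inE.
have : A #|T|.-1 == setT.
  by rewrite eqEcard subsetT cardsT; lia.
by move=> /eqP/setP/(_ v); rewrite !inE.
Qed.

Lemma turns_gt0 t u : K.+1 * #|T| ^ 3 <= t -> 0 < turns t u.
Proof.
move=> t_ge; rewrite lt0n; apply/eqP => u0.
have T_gt0 : 0 < #|T| by apply/card_gt0P; exists u.
suff lt_t : t < K.+1 * #|T| ^ 3 by move: t_ge; rewrite leqNgt lt_t.
(* The degree is at most [#|T|], and the other factor is at most [#|T|.-1 * K.+1 + K]. *)
have vis v : (visits w t v).+1 <= #|T| * (#|T| * K.+1).
  apply: leq_trans (visits_lt t v) _; apply: leq_mul (max_card _) _.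
  have := turns_spread v u0; have := multiplicity_le v.
  by rewrite -[in X in _ -> _ -> _ <= X](prednK T_gt0) mulSn; lia.
(* Each vertex contributes one spare unit; as [#|T|] is positive, this makes the bound on [t]
   strict. *)
have : t + #|T| <= #|T| * (#|T| * (#|T| * K.+1)).
  rewrite -[leqRHS]sum_nat_const -{1}(sum_visits w t) -{1}sum1_card -big_split.
  by apply: leq_sum => v _; rewrite /= addn1.
rewrite !expnS expn0 muln1; lia.
Qed.

Lemma edges_covered_cubic : edges_covered e w (K.+1 * #|T| ^ 3).
Proof.
move=> u v euv; apply: crossings_traversed.
have /andP[le_c _] := crossings_bounds (K.+1 * #|T| ^ 3) euv.
exact: leq_trans (turns_gt0 u (leqnn _)) le_c.
Qed.

End Walk.

(** * Existence of walks, lollipop graphs and the cover time *)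

Lemma exists_det_walk (T : finType) (e : rel T) (d : T -> nat) (x : T) :
  rotor_lengths e d -> exists w, is_det_walk e d w.
Proof.
move=> dP; pose rho u := flatten (nseq (d u %/ deg e u) (enum [set v | e u v])).
exists (walk rho (fun=> 0) x), x, rho, (fun=> 0); split=> // [u|u]; last first.
  by case: (dP u).
have [d_gt0 dvd_d] := dP u; split.
- rewrite size_flatten /shape map_nseq sumn_nseq -cardE mulnC -/(deg e u).
  by rewrite divnK.
- move=> v /flattenP[s]; rewrite mem_nseq => /andP[_ /eqP->].
  by rewrite mem_enum inE.
move=> v euv; rewrite count_flatten map_nseq sumn_nseq.
by rewrite count_uniq_mem ?enum_uniq // mem_enum inE euv mul1n.
Qed.

(** Consecutive labels are adjacent in the clique as well as on the path, so induction on the label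
    reaches every vertex from label 0. *)
Lemma lollipop_connected (T : finType) (e : rel T) : is_lollipop e ->
  symmetric e /\ forall u v, connect e u v.
Proof.
case=> T_gt0 _ [f [g fK gK] ef].
have e_sym : symmetric e.
  move=> u v; rewrite !ef /lollipop_adj eq_sym [in RHS](andbC (f v < _)).
  by congr (_ && (_ || _)); rewrite orbC.
split=> //; pose o := Ordinal T_gt0.
have conn0 k (lt_k : k < #|T|) : connect e (g o) (g (Ordinal lt_k)).
  elim: k lt_k => [|k IHk] lt_k.
    by rewrite (_ : Ordinal lt_k = o) ?connect0 //; apply: val_inj.
  apply: connect_trans (IHk (ltnW lt_k)) (connect1 _).
  rewrite ef !gK /lollipop_adj -val_eqE /= eqxx orbT andbT.
  by rewrite neq_ltn ltnSn.
have conn u : connect e (g o) u.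
  by rewrite -(fK u); case: (f u) => k lt_k; apply: conn0.
move=> u v; apply: connect_trans (conn v).
by rewrite (sym_connect_sym e_sym).
Qed.

Theorem theorem3p18 :
  forall K : nat, exists C : nat,
  forall (T : finType) (e : rel T) (d : T -> nat),
    is_lollipop e -> rotor_lengths e d -> kappa e d <= K ->
    exists2 N : nat, is_edge_cover_time e d N & N <= C * #|T| ^ 3.
Proof.
move=> K; exists K.+1 => T e d lol dP kappa_le.
have [e_sym e_conn] := lollipop_connected lol.
have covered w : is_det_walk e d w -> edges_covered e w (K.+1 * #|T| ^ 3).
  by case=> x [rho [p [rhoP pP ->]]]; apply: edges_covered_cubic.
have first_time w : is_det_walk e d w -> exists t, first_cover_time e w t.
  by move=> /covered/exists_least[t cov_t min_t]; exists t.
(* The first cover times form a nonempty set, bounded by [covered]; its greatest element is the edge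
   cover time. *)
pose P N := exists2 w, is_det_walk e d w & first_cover_time e w N.
have leB N : P N -> N <= K.+1 * #|T| ^ 3.
  by case=> w /covered cov_w [_ min_N]; apply: min_N.
have [x _] : exists x : T, x \in T by case: lol => /card_gt0P.
have [w0 w0P] := exists_det_walk x dP; have [t0 t0P] := first_time w0 w0P.
have [|N PN maxN] := @exists_greatest P t0 _ _ leB; first by exists w0.
exists N; last exact: leB.
split=> // w wP; have [t tP] := first_time w wP.
by exists t => //; apply: maxN; exists w.
Qed.
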